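(* Let $\mathcal T=\{T_1,\dots,T_m\}\subset\mathbb C^{d\times d}$ be a family of matrices that are all upper triangular or all lower triangular, with nonzero diagonal entries $(T_i)_{jj}=\lambda_j^{(i)}$, and with probability weights $p_1,\dots,p_m$. Then the random spectral radius satisfies $$\rho_n(\mathcal T,\mathbb P_{\mathcal T})\xrightarrow{\text{a.s.}}\rho_\infty(\mathcal T,\mathbb P_{\mathcal T})\qquad\text{as }n\to\infty,$$ where $$\rho_\infty(\mathcal T,\mathbb P_{\mathcal T}):=\max_{1\le j\le d}\rho_\infty^{(j)}(\mathcal T,\mathbb P_{\mathcal T}),\qquad \rho_\infty^{(j)}(\mathcal T,\mathbb P_{\mathcal T}):=\prod_{i=1}^m|\lambda_j^{(i)}|^{p_i}.$$ Equivalently, $\mathbb P\bigl(\lim_{n\to\infty}\rho_n(\mathcal T,\mathbb P_{\mathcal T})=\rho_\infty(\mathcal T,\mathbb P_{\mathcal T})\bigr)=1$.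
   Context: $\mathbb P_{\mathcal T}$ assigns mass $p_i\ge 0$ to $T_i$, with $\sum_i p_i=1$. Let $(i_k)_{k\ge1}$ be i.i.d. random indices in $\{1,\dots,m\}$ with $\mathbb P(i_k=i)=p_i$. The random spectral radius of length $n$ is $\rho_n(\mathcal T,\mathbb P_{\mathcal T}):=\rho(T_{i_n}\cdots T_{i_1})^{1/n}$, where $\rho(\cdot)$ is the spectral radius of a matrix. *)

(* Defs.v *)
From HB Require Import structures.
From mathcomp Require Import all_boot all_order all_algebra finmap.
From mathcomp Require Import complex.
From mathcomp Require Import all_classical all_reals all_analysis.

Set Implicit Arguments.
Unset Strict Implicit.
Unset Printing Implicit Defensive.

Import Order.TTheory GRing.Theory Num.Theory.
Import numFieldNormedType.Exports.

Local Open Scope classical_set_scope.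
Local Open Scope ring_scope.
Local Open Scope complex_scope.

Section Spectral.
Variable R : realType.

(* [eigenvalue] uses row eigenvectors; the eigenvalues are those of column
   eigenvectors. For d > 0 the set is finite and nonempty, so sup is a max;
   [normc] is the R-valued modulus. *)
Definition spectral_radius (d : nat) (A : 'M[R[i]]_d) : R :=
  sup [set ComplexField.Normc.normc z | z in [set z | eigenvalue A z]].

End Spectral.

Section IID.
Context (R : realType) (dsp : measure_display) (Omega : measurableType dsp).
Variables (P : probability Omega R) (m : nat).
Implicit Types (X : nat -> Omega -> 'I_m) (p : 'I_m -> R).

(* The sigma-algebra on 'I_m is the discrete one. *)
Definition index_random_variable (Y : Omega -> 'I_m) : Prop :=
  forall A : set 'I_m, measurable (Y @^-1` A).

Definition mutually_independent X : Prop :=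
  forall (J : {fset nat}) (A : nat -> set 'I_m),
    P (\bigcap_(k in [set` J]) (X k @^-1` A k)) =
    (\prod_(k <- J) P (X k @^-1` A k))%E.

Definition iid_indices p X : Prop :=
  [/\ forall k, index_random_variable (X k),
      forall k i, P (X k @^-1` [set i]) = (p i)%:E
    & mutually_independent X].

End IID.

Section RandomSpectralRadius.
Context (R : realType) (d m : nat) (T : 'I_m -> 'M[R[i]]_d).

(* T_(s (n-1)) *m ... *m T_(s 0): the sequence of indices is numbered from 0. *)
Fixpoint random_product (s : nat -> 'I_m) (n : nat) : 'M[R[i]]_d :=
  if n is k.+1 then T (s k) *m random_product s k else 1%:M.

(* At n = 0 the exponent 0^-1 = 0 makes this a junk value. *)
Definition random_spectral_radius (s : nat -> 'I_m) (n : nat) : R :=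
  spectral_radius (random_product s n) `^ (n%:R^-1).

Definition rho_infty_diag (p : 'I_m -> R) (j : 'I_d) : R :=
  \prod_(i < m) ComplexField.Normc.normc (T i j j) `^ p i.

(* The terms are nonnegative, so the default 0 does not affect the maximum. *)
Definition rho_infty (p : 'I_m -> R) : R :=
  \big[Num.max/0]_(j < d) rho_infty_diag p j.

End RandomSpectralRadius.

(* [is_trig_mx] is lower triangularity. *)
Definition is_upper_trig_mx (R : realType) (d : nat) (A : 'M[R[i]]_d) : bool :=
  is_trig_mx A^T.

(* Main.v *)
(* The spectral radius of a triangular matrix is the largest modulus of a
   diagonal entry, and the diagonal of a product of triangular matrices is the
   product of the diagonals.  Hence rho_n is the maximum over j of
   exp (sum_i f_i(n) ln |T_i j j|), where f_i(n) is the empirical frequency of the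
   index i, and continuity reduces the theorem to f_i(n) -> p_i almost surely.
   For this strong law let Z_n be the centred number of occurrences of i before
   time n.  Pairwise independence gives E[Z_n^2] <= n, so the series of
   E[(Z_(k^2) / k^2)^2] converges, hence so does the series of (Z_(k^2) / k^2)^2
   almost surely, and its terms tend to 0.  Since Z has steps at most 1 and
   consecutive squares differ by O(k), Z_n / n tends to 0 along all n. *)
Require Import Defs.
From HB Require Import structures.
From mathcomp Require Import all_boot all_order all_algebra finmap.
From mathcomp Require Import complex.
From mathcomp Require Import all_classical all_reals all_analysis.
From mathcomp Require Import measurable_realfun lra ring zify.

Set Implicit Arguments.
Unset Strict Implicit.
Unset Printing Implicit Defensive.

Import Order.TTheory GRing.Theory Num.Theory.
Import numFieldNormedType.Exports.

Local Open Scope classical_set_scope.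
Local Open Scope ring_scope.
Local Open Scope complex_scope.

(** * Spectral radii of products of triangular matrices *)

Lemma is_trig_mxM (K : pzRingType) (d : nat) (A B : 'M[K]_d) :
  is_trig_mx A -> is_trig_mx B -> is_trig_mx (A *m B).
Proof.
move=> /is_trig_mxP At /is_trig_mxP Bt; apply/is_trig_mxP => i j ij.
rewrite mxE big1 // => k _.
case: (ltnP i k) => [ik|ki]; first by rewrite At // mul0r.
by rewrite Bt ?mulr0 // (leq_ltn_trans ki).
Qed.

Lemma trig_mxM_diag (K : pzRingType) (d : nat) (A B : 'M[K]_d) (j : 'I_d) :
  is_trig_mx A -> is_trig_mx B -> (A *m B) j j = A j j * B j j.
Proof.
move=> /is_trig_mxP At /is_trig_mxP Bt; rewrite mxE (bigD1 j) //= big1 ?addr0 //.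
move=> k kj; case: (ltngtP j k) => [jk|jk|/val_inj jk].
- by rewrite At // mul0r.
- by rewrite Bt // mulr0.
- by rewrite jk eqxx in kj.
Qed.

Lemma char_poly_trmx (K : comNzRingType) (d : nat) (A : 'M[K]_d) :
  char_poly A^T = char_poly A.
Proof.
rewrite /char_poly -[RHS]det_tr; congr (\det _).
by apply/matrixP => i j; rewrite !mxE eq_sym.
Qed.

Section TriangularProducts.
Variables (R : realType) (d m : nat).
Local Notation normc := (@ComplexField.Normc.normc R).
Implicit Types (A : 'M[R[i]]_d) (T : 'I_m -> 'M[R[i]]_d).

Lemma normc_ge0 (z : R[i]) : 0 <= normc z.
Proof. by case: z => a b; exact: sqrtr_ge0. Qed.

Lemma spectral_radius_trmx A : spectral_radius A^T = spectral_radius A.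
Proof.
have eigE : eigenvalue A^T = eigenvalue A.
  by apply/funext => z; rewrite !eigenvalue_root_char char_poly_trmx.
by rewrite /spectral_radius eigE.
Qed.

(** The characteristic polynomial splits as the product of the ['X - A j j], so the eigenvalues are
    exactly the diagonal entries. For [d = 0] both sides are 0, since [sup set0 = 0]. *)
Lemma spectral_radius_trig A : is_trig_mx A ->
  spectral_radius A = \big[Num.max/0]_(j < d) normc (A j j).
Proof.
move=> Atrig.
have eigA z : eigenvalue A z <-> exists j, z = A j j.
  rewrite eigenvalue_root_char char_poly_trig // /root horner_prod prodf_seq_eq0.
  split=> [/hasP[j _]|[j ->]].
    by rewrite /= hornerXsubC subr_eq0 => /eqP ->; exists j.
  by apply/hasP; exists j; rewrite ?mem_index_enum //= hornerXsubC subrr.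
rewrite /spectral_radius.
set S := [set normc z | z in _]; set b := \big[_/_]_(_ < _) _.
have [d0|dgt0] := posnP d.
  have noord (j : 'I_d) : False by have := leq_trans (ltn_ord j) (eq_leq d0).
  have -> : S = set0 by apply/seteqP; split=> // t [z /eigA[j _] _]; case: (noord j).
  by rewrite sup0 /b big_pred0 // => j; case: (noord j).
(* With an index available and all moduli nonnegative, the default 0 is harmless and the maximum is
   attained. *)
have [j _ bj] : {j | j \in predT & b = normc (A j j)}.
  by apply: (eq_bigmax (Ordinal dgt0)) => // j _; exact: normc_ge0.
have ubS : ubound S b.
  by move=> _ [z /eigA[k ->] <-]; apply: (le_bigmax _ (fun j => normc (A j j))).
have Sb : S b by exists (A j j) => //; apply/eigA; exists j.
apply/le_anti/andP; split; first by apply: ge_sup => //; exists b.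
by apply: ub_le_sup => //; exists b.
Qed.

Lemma random_product_trig T (s : nat -> 'I_m) n :
  (forall i, is_trig_mx (T i)) -> is_trig_mx (random_product T s n).
Proof.
move=> Ttrig; elim: n => [|n ih] /=; last exact: is_trig_mxM.
by apply/is_trig_mxP => i j ij; rewrite mxE -val_eqE (ltn_eqF ij).
Qed.

Lemma random_product_trig_diag T (s : nat -> 'I_m) n j :
  (forall i, is_trig_mx (T i)) ->
  random_product T s n j j = \prod_(k < n) T (s k) j j.
Proof.
move=> Ttrig; elim: n => [|n ih] /=; first by rewrite big_ord0 mxE eqxx.
by rewrite trig_mxM_diag // ?random_product_trig // ih big_ord_recr mulrC.
Qed.

(* Transposition reverses products, but not the commutative product of diagonal
   entries; so it reduces the upper triangular case to the lower one. *)
Lemma random_product_upper_trig T (s : nat -> 'I_m) n :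
  (forall i, is_upper_trig_mx (T i)) ->
  is_trig_mx (random_product T s n)^T /\
  forall j, random_product T s n j j = \prod_(k < n) T (s k) j j.
Proof.
move=> Ttrig; elim: n => [|n [ih1 ih2]] /=.
  split=> [|j]; last by rewrite big_ord0 mxE eqxx.
  by apply/is_trig_mxP => i j ij; rewrite !mxE -val_eqE (gtn_eqF ij).
split=> [|j]; first by rewrite trmx_mul is_trig_mxM //; exact: Ttrig.
rewrite big_ord_recr -ih2 /=.
have -> : (T (s n) *m random_product T s n) j j =
    ((T (s n) *m random_product T s n)^T) j j by rewrite [RHS]mxE.
rewrite trmx_mul trig_mxM_diag //; last exact: Ttrig.
by rewrite !mxE.
Qed.

Lemma spectral_radius_random_product T (s : nat -> 'I_m) n :
  (forall i, is_upper_trig_mx (T i)) \/ (forall i, is_trig_mx (T i)) ->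
  spectral_radius (random_product T s n) =
  \big[Num.max/0]_(j < d) \prod_(k < n) normc (T (s k) j j).
Proof.
have normc_prod j : normc (\prod_(k < n) T (s k) j j) =
    \prod_(k < n) normc (T (s k) j j).
  elim/big_rec2: _ => [|k y z _ <-]; first exact: ComplexField.Normc.normc1.
  exact: ComplexField.Normc.normcM.
case=> Ttrig.
  have [trig diag] := random_product_upper_trig s n Ttrig.
  rewrite -spectral_radius_trmx spectral_radius_trig //.
  by apply: eq_bigr => j _; rewrite mxE diag normc_prod.
rewrite spectral_radius_trig ?random_product_trig //.
by apply: eq_bigr => j _; rewrite random_product_trig_diag // normc_prod.
Qed.

End TriangularProducts.

(** * Deterministic limits: fixed index sequences with given frequencies, and averages controlled
    along squares *)

Section DeterministicLimit.
Variables (R : realType) (d m : nat) (T : 'I_m -> 'M[R[i]]_d).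
Local Notation normc := (@ComplexField.Normc.normc R).

(** Take logarithms and group the factors by the value of [s k]; positivity of [a] makes [ln]
    invertible by [expR]. *)
Lemma prod_powR_frequency (a : 'I_m -> R) (s : nat -> 'I_m) n :
  (forall i, 0 < a i) ->
  (\prod_(k < n) a (s k)) `^ n%:R^-1 =
  expR (\sum_(i < m) (\sum_(k < n) (s k == i)%:R) / n%:R * ln (a i)).
Proof.
move=> a0.
have -> : \prod_(k < n) a (s k) = expR (\sum_(k < n) ln (a (s k))).
  by rewrite expR_sum; apply: eq_bigr => k _; rewrite lnK // posrE.
rewrite -expRM; congr expR.
under [RHS]eq_bigr => i _ do rewrite mulrAC mulr_suml.
rewrite -mulr_suml exchange_big /=; congr (_ / _); apply: eq_bigr => k _.
rewrite (bigD1 (s k)) //= eqxx mul1r big1 ?addr0 // => i isk.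
by rewrite eq_sym (negPf isk) mul0r.
Qed.

(** A power with positive exponent is nondecreasing on nonnegative reals and fixes the default 0, so
    it commutes with the maximum. *)
Lemma powR_bigmax (F : 'I_d -> R) (r : R) :
  0 < r -> (forall j, 0 <= F j) ->
  (\big[Num.max/0]_(j < d) F j) `^ r = \big[Num.max/0]_(j < d) F j `^ r.
Proof.
move=> r0 F0.
suff [] : (\big[Num.max/0]_(j < d) F j) `^ r = \big[Num.max/0]_(j < d) F j `^ r
  /\ 0 <= \big[Num.max/0]_(j < d) F j by [].
elim/big_rec2: _ => [|j x y _ [<- y0]]; first by rewrite powR0 // gt_eqF.
split; last by rewrite le_max F0.
have homo := ge0_ler_powR (ltW r0).
case: (leP (F j) y) => Fy.
  by rewrite max_r // homo ?nnegrE.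
by rewrite max_l // homo ?nnegrE // ltW.
Qed.

Lemma random_spectral_radius_cvg (p : 'I_m -> R) (s : nat -> 'I_m) :
  (forall i, is_upper_trig_mx (T i)) \/ (forall i, is_trig_mx (T i)) ->
  (forall i j, T i j j != 0) ->
  (forall i, (\sum_(k < n) (s k == i)%:R) / n%:R @[n --> \oo] --> p i) ->
  random_spectral_radius T s n @[n --> \oo] --> rho_infty T p.
Proof.
move=> Ttrig Tdiag sp.
have Tpos i j : 0 < normc (T i j j).
  rewrite lt_neqAle normc_ge0 andbT eq_sym; apply/eqP => /ComplexField.Normc.eq0_normc.
  exact/eqP.
have rhoE j : rho_infty_diag T p j = expR (\sum_(i < m) p i * ln (normc (T i j j))).
  rewrite expR_sum; apply: eq_bigr => i _.
  by rewrite mulrC expRM lnK // posrE.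
rewrite /rho_infty.
have : \big[Num.max/0]_(j < d)
    expR (\sum_(i < m) (\sum_(k < n) (s k == i)%:R) / n%:R * ln (normc (T i j j)))
    @[n --> \oo] --> \big[Num.max/0]_(j < d) rho_infty_diag T p j.
  apply: cvg_big; first exact: max_continuous.
  move=> j _; rewrite rhoE; apply: (cvg_comp _ expR); last exact: continuous_expR.
  apply: cvg_big; first exact: add_continuous.
  by move=> i _; apply: cvgMl; exact: sp.
(* The two sequences need only agree for [n > 0], where the exponent [n%:R^-1] is positive. *)
apply: cvg_trans; apply: near_eq_cvg; near=> n.
have n0 : 0 < n%:R^-1 :> R by rewrite invr_gt0 ltr0n; near: n; exact: nbhs_infty_gt.
rewrite /random_spectral_radius spectral_radius_random_product //.
rewrite powR_bigmax // => [|j]; last by apply: prodr_ge0 => k _; exact: normc_ge0.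
by apply: eq_bigr => j _; rewrite (prod_powR_frequency (a := fun i => normc (T i j j))).
Unshelve. all: by end_near. Qed.

(** Between consecutive squares [z] moves by at most the gap, which is O(k) and hence negligible
    against k^2. *)
Lemma cvg_average_of_cvg_squares (z : nat -> R) :
  (forall n, `|z n.+1 - z n| <= 1) ->
  z (k ^ 2)%N / k%:R ^+ 2 @[k --> \oo] --> 0 ->
  z n / n%:R @[n --> \oo] --> 0.
Proof.
move=> zS zsq.
have zD n j : `|z (n + j)%N - z n| <= j%:R.
  elim: j => [|j ih]; first by rewrite addn0 subrr normr0.
  by rewrite addnS -nat1r (le_trans (ler_distD (z (n + j)%N) _ _)) // lerD.
apply/cvgrPdist_le => e e0.
have e20 : 0 < e / 2 by rewrite divr_gt0.
have [K1 _ HK1] := (cvgrPdist_le _ _).1 zsq _ e20.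
(* For [k >= K], both [|z (k ^ 2)| <= e / 2 * k ^ 2] and [2 * k <= e / 2 * k ^ 2] hold; the latter
   is [4 / e <= k]. Their sum is at most [e * n]. *)
pose K := (K1 + (Num.truncn (4 / e)).+1)%N.
exists (K ^ 2)%N => // n /= Kn.
pose k := Nat.sqrt n.
have [/ssrnat.leP kn /ssrnat.ltP nk] := PeanoNat.Nat.sqrt_spec' n.
have Kk : (K <= k)%N by rewrite /k; nia.
(* From [k ^ 2 <= n < k.+1 ^ 2], the excess over the square is at most [2 * k]. *)
have [j nE jk] : exists2 j, n = (k ^ 2 + j)%N & (j <= 2 * k)%N.
  by exists (n - k ^ 2)%N; rewrite /k; nia.
have k0 : (0 < k%:R :> R) by rewrite ltr0n; lia.
have k2n : k%:R ^+ 2 <= n%:R :> R by rewrite -natrX ler_nat nE leq_addr.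
have n0 : 0 < n%:R :> R by rewrite (lt_le_trans _ k2n) // exprn_gt0.
have : `|z (k ^ 2)%N| <= e / 2 * k%:R ^+ 2.
  have := HK1 k; rewrite sub0r normrN normf_div /= => /(_ ltac:(lia)).
  by rewrite ler_pdivrMr ?normr_gt0 ?gt_eqF ?exprn_gt0 // (ger0_norm (exprn_ge0 _ (ltW k0))).
have : 4 / e <= k%:R.
  by apply/ltW/(lt_le_trans (truncnS_gt _)); rewrite ler_nat (leq_trans _ Kk) // leq_addl.
rewrite ler_pdivrMr // => ke zk.
have zn := zD (k ^ 2)%N j; rewrite -nE in zn.
have jk' : j%:R <= 2 * k%:R :> R by rewrite -natrM ler_nat.
rewrite sub0r normrN normf_div (gtr0_norm n0) ler_pdivrMr //.
have : `|z n| <= `|z n - z (k ^ 2)%N| + `|z (k ^ 2)%N|.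
  by rewrite -{1}(subrK (z (k ^ 2)%N) (z n)) ler_normD.
nra.
Qed.

End DeterministicLimit.

(** * Strong law for pairwise independent events of equal probability *)

Section StrongLawForEvents.
Context (R : realType) (dsp : measure_display) (Omega : measurableType dsp).
Variables (P : probability Omega R) (A : nat -> set Omega) (a : R).
Hypothesis mA : forall k, measurable (A k).
Hypothesis PA : forall k, P (A k) = a%:E.
Hypothesis PAA : forall k l, k != l -> P (A k `&` A l) = (a ^+ 2)%:E.

Let D k w : R := \1_(A k) w - a.
Let Z n w : R := \sum_(k < n) D k w.

Let a01 : 0 <= a <= 1.
Proof.
by rewrite -!lee_fin -(PA 0) probability_le1 ?measure_ge0.
Qed.

Let mD k : measurable_fun setT (D k).
Proof. by apply: measurable_funB; [exact: measurable_indic|exact: measurable_cst]. Qed.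

Let mZ n : measurable_fun setT (Z n).
Proof. by apply: measurable_sum => k; exact: mD. Qed.

Let indicE01 (B : set Omega) w : \1_B w = 0 :> R \/ \1_B w = 1 :> R.
Proof. by rewrite indicE; case: (w \in B); [right|left]. Qed.

Let D_le1 k w : `|D k w| <= 1.
Proof.
by rewrite /D ler_norml; case: (indicE01 (A k) w) => ->; case/andP: a01; lra.
Qed.

Let integrable_indic B : measurable B -> P.-integrable setT (EFin \o (\1_B : Omega -> R)).
Proof.
move=> mB; apply: measurable_bounded_integrable => //.
- by rewrite -ge0_fin_numE ?measure_ge0 // fin_num_measure.
- exists 1; split=> // x x1 w _ /=.
  by case: (indicE01 B w) => ->; rewrite ?normr0 ?normr1; lra.
Qed.

Let integrable_DD k l : P.-integrable setT (EFin \o (fun w => D k w * D l w)).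
Proof.
apply: measurable_bounded_integrable => //.
- by rewrite -ge0_fin_numE ?measure_ge0 // fin_num_measure.
- by apply: measurable_funM.
- exists 1; split=> // x x1 w _ /=; rewrite normrM.
  by apply: le_trans (ltW x1); rewrite mulr_ile1.
Qed.

(** Expanding the product of centred indicators leaves P(A_k ∩ A_l) - a^2, which vanishes off the
    diagonal by [PAA]. *)
Let covariance_events k l :
  (\int[P]_w (D k w * D l w)%:E = (if k == l then a - a ^+ 2 else 0)%:E)%E.
Proof.
have DDE w : (D k w * D l w)%:E =
    ((\1_(A k `&` A l) w)%:E + (- a)%:E * (\1_(A k) w)%:E +
     ((- a)%:E * (\1_(A l) w)%:E + cst (a ^+ 2)%:E w))%E.
  rewrite -!EFinM /= -!EFinD indicI /D /=; congr EFin; ring.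
have iZ B : measurable B ->
    P.-integrable setT (fun w => (- a)%:E * (\1_B w)%:E)%E.
  by move=> mB; apply: integrableZl => //; exact: integrable_indic.
have iI := integrable_indic (measurableI _ _ (mA k) (mA l)).
have icst := finite_measure_integrable_cst P (a ^+ 2) (@measurableT _ Omega).
under eq_integral => w _ do rewrite DDE.
rewrite integralD //; last 2 first.
- by apply: integrableD => //; exact: iZ.
- by apply: integrableD => //; exact: iZ.
rewrite integralD //; last exact: iZ.
rewrite integralD //; last exact: iZ.
rewrite !integralZl //; try exact: integrable_indic.
rewrite !integral_indic ?setIT //; last exact: measurableI.
rewrite integral_cst //= (probability_setT P) mule1 !PA -!EFinM.
case: eqVneq => [<-|kl]; first by rewrite setIid PA -!EFinD; congr EFin; ring.
by rewrite PAA // -!EFinD; congr EFin; ring.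
Qed.

Let second_moment n : (\int[P]_w (Z n w ^+ 2)%:E = (n%:R * (a - a ^+ 2))%:E)%E.
Proof.
under eq_integral => w _.
  rewrite /Z expr2 big_distrlr /= pair_big -sumEFin /=; over.
rewrite integral_sum //; last by move=> kl; exact: integrable_DD.
under eq_bigr => kl _ do rewrite covariance_events.
rewrite sumEFin -(pair_big xpredT xpredT
  (fun k l : 'I_n => if k == l :> nat then a - a ^+ 2 else 0)) /=; congr EFin.
under eq_bigr => k _.
  rewrite (bigD1 k) //= eqxx big1 ?addr0; last first.
    by move=> l lk; rewrite eq_sym -val_eqE in lk *; rewrite (negPf lk).
  over.
by rewrite sumr_const card_ord mulr_natl.
Qed.

(** The index is shifted to [k.+1] so that no denominator is zero. *)
Let Y k w : R := (Z (k.+1 ^ 2)%N w / k.+1%:R ^+ 2) ^+ 2.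

Let integral_Y_le k : (\int[P]_w (Y k w)%:E <= (k.+1%:R ^- 2)%:E)%E.
Proof.
have YE w : (Y k w)%:E = ((k.+1%:R ^- 4)%:E * (Z (k.+1 ^ 2)%N w ^+ 2)%:E)%E.
  by rewrite -EFinM /Y expr_div_n mulrC -exprM.
under eq_integral => w _ do rewrite YE.
rewrite ge0_integralZl //; last 2 first.
- by apply/measurable_EFinP; exact: measurable_funX.
- by move=> w _; rewrite lee_fin sqr_ge0.
rewrite second_moment -EFinM lee_fin natrX mulrA.
rewrite -[leRHS]mulr1; have k0 : k.+1%:R != 0 :> R by rewrite pnatr_eq0.
rewrite (_ : _ ^- 4 * _ = k.+1%:R ^- 2); last by field.
(* What remains is [a - a ^+ 2 <= 1], which follows from [0 <= a <= 1]. *)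
by rewrite ler_pM2l ?invr_gt0 ?exprn_gt0 //; case/andP: a01; nra.
Qed.

Let sum_inv_sq n : \sum_(k < n) k.+1%:R ^- 2 <= 2 :> R.
Proof.
case: n => [|n]; first by rewrite big_ord0.
(* The sharper bound carries the induction: each new term is at most the telescoping difference of
   consecutive inverses. *)
suff : \sum_(k < n.+1) k.+1%:R ^- 2 <= 2 - n.+1%:R^-1 :> R.
  by move=> /le_trans; apply; rewrite gerBl invr_ge0.
elim: n => [|n ih]; first by rewrite big_ord1 expr1n invr1; lra.
rewrite big_ord_recr /= -[n.+2%:R]natr1; set x : R := n.+1%:R in ih *.
have x0 : 0 < x by rewrite ltr0n.
have x1 : 0 < x + 1 by rewrite ltr_wpDr.
apply: le_trans (lerD ih (lexx _)) _; rewrite -subr_ge0.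
rewrite (_ : _ - _ = x^-1 * (x + 1) ^- 2); last by field; rewrite !gt_eqF.
by rewrite mulr_ge0 ?invr_ge0 ?exprn_ge0 ?ltW.
Qed.

(** Integrating the nonnegative series term by term bounds its expectation by 2, so the sum is
    finite almost everywhere and its terms tend to 0. *)
Let Y_cvg0 : {ae P, forall w, Y k w @[k --> \oo] --> 0}.
Proof.
have Y0 k w : 0 <= Y k w by exact: sqr_ge0.
have mY k : measurable_fun setT (EFin \o Y k).
  apply/measurable_EFinP; apply: measurable_funX.
  by apply: measurable_funM => //.
have int_sum : P.-integrable setT (fun w => \sum_(0 <= k <oo) (Y k w)%:E)%E.
  apply/integrableP; split.
    apply: ge0_emeasurable_sum => [k w _ _|k _]; first by rewrite lee_fin.
    exact: mY.
  under eq_integral => w _.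
    rewrite gee0_abs; last by apply: nneseries_ge0 => k _ _; rewrite lee_fin.
    over.
  rewrite integral_nneseries //; last by move=> k w _; rewrite lee_fin.
  apply: (@le_lt_trans _ _ 2%:E); last exact: ltry.
  apply: lime_le.
    apply: is_cvg_nneseries => k _ _.
    by apply: integral_ge0 => w _; rewrite lee_fin.
  near=> n; rewrite big_mkord.
  apply: (@le_trans _ _ (\sum_(k < n) (k.+1%:R ^- 2)%:E)%E).
    by apply: lee_sum => k _; exact: integral_Y_le.
  by rewrite sumEFin lee_fin sum_inv_sq.
apply: filterS (integrable_ae measurableT int_sum) => w /(_ Logic.I) fin_sum.
(* The partial sums increase and are bounded by the finite extended-real sum, so the real series
   converges. *)
apply: cvg_series_cvg_0; apply: nondecreasing_is_cvgn.
  by apply/nondecreasing_seqP => n; rewrite !seriesEord /= big_ord_recr lerDl.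
exists (fine (\sum_(0 <= k <oo) (Y k w)%:E)%E) => _ [n _ <-].
rewrite -lee_fin fineK // seriesEnat /= -sumEFin.
by apply: nneseries_lim_ge => k _ _; rewrite lee_fin.
Unshelve. all: by end_near. Qed.

Lemma strong_law_events :
  {ae P, forall w, (\sum_(k < n) \1_(A k) w) / n%:R @[n --> \oo] --> a}.
Proof.
apply: filterS Y_cvg0 => w Yw.
have Z0 : Z n w / n%:R @[n --> \oo] --> 0.
  apply: (cvg_average_of_cvg_squares (z := fun n => Z n w)).
    by move=> n; rewrite /Z big_ord_recr /= [_ + D n w]addrC addrK.
  rewrite -(cvg_shiftS (fun k => Z (k ^ 2)%N w / k%:R ^+ 2)) /=.
  (* Continuity of the square root at 0 turns the convergence of squares into that of absolute
     values. *)
  have /(cvg_comp _ Num.sqrt) : Y k w @[k --> \oo] --> 0 by [].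
  move=> /(_ _ (@sqrt_continuous R 0)); rewrite sqrtr0 => sqrtY.
  by apply/norm_cvg0P; move: sqrtY; under eq_cvg do rewrite /= /Y sqrtr_sqr.
have : Z n w / n%:R + a @[n --> \oo] --> a.
  by rewrite -[X in _ --> X]add0r; apply: cvgD => //; exact: cvg_cst.
apply: cvg_trans; apply: near_eq_cvg; near=> n.
have n0 : n%:R != 0 :> R by rewrite pnatr_eq0 -lt0n; near: n; exact: nbhs_infty_gt.
rewrite /Z sumrB sumr_const card_ord -[a *+ n]mulr_natl mulrBl
  [_ * a / _]mulrAC divff // mul1r.
by rewrite subrK.
Unshelve. all: by end_near. Qed.

End StrongLawForEvents.

(** * Measurability of the convergence event, and application to the random indices *)

Lemma measurable_cvg_set (R : realType) (dsp : measure_display)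
    (Omega : measurableType dsp) (f : nat -> Omega -> R) (c : R) :
  (forall n, measurable_fun setT (f n)) ->
  measurable [set w | f n w @[n --> \oo] --> c].
Proof.
move=> mf.
(* Testing convergence only on tolerances [k.+1%:R^-1] makes every union and intersection
   countable. *)
rewrite (_ : [set w | _] = \bigcap_k \bigcup_N \bigcap_(n in [set n | (N <= n)%N])
    [set w | `|c - f n w| < k.+1%:R^-1]).
  apply: bigcap_measurable => // k _; apply: bigcup_measurable => N _.
  apply: bigcap_measurable => [|n _]; first by exists N => /=.
  rewrite -[X in measurable X]setTI.
  have mcf : measurable_fun setT (fun w => `|c - f n w|).
    by apply: measurableT_comp => //; exact: measurable_funB.
  by rewrite -preimage_itvNyo; exact: mcf.
apply/seteqP; split => w /=.
  move=> /cvgrPdist_lt fc k _.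
  have [|N _ HN] := fc k.+1%:R^-1; first by rewrite invr_gt0.
  by exists N => // n Nn; exact: HN.
move=> fc; apply/cvgrPdist_lt => e e0.
have [k ke] : exists k, k.+1%:R^-1 < e.
  exists (Num.truncn e^-1); rewrite invf_plt ?posrE // truncnS_gt //.
have [N _ HN] := fc k Logic.I.
by exists N => // n Nn; apply: lt_trans ke; exact: HN.
Qed.

Lemma measurable_random_spectral_radius (R : realType) (d m : nat)
    (T : 'I_m -> 'M[R[i]]_d) (dsp : measure_display) (Omega : measurableType dsp)
    (X : nat -> Omega -> 'I_m) (n : nat) :
  (forall i, is_upper_trig_mx (T i)) \/ (forall i, is_trig_mx (T i)) ->
  (forall k, index_random_variable (X k)) ->
  measurable_fun setT (fun w => random_spectral_radius T (X ^~ w) n).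
Proof.
move=> Ttrig mX; rewrite /random_spectral_radius.
under eq_fun do rewrite spectral_radius_random_product //.
apply: (measurableT_comp (measurable_powR _)).
elim: (index_enum _) => [|j s ih].
  by under eq_fun do rewrite big_nil; exact: measurable_cst.
under eq_fun do rewrite big_cons.
apply: measurable_maxr => //; apply: measurable_prod => k _ _ B _.
(* Each factor is a function of [X k] alone, and every set of indices has a measurable preimage. *)
rewrite setTI; exact: (mX k [set i | B (ComplexField.Normc.normc (T i j j))]).
Qed.

Lemma iid_indices_frequency_cvg (R : realType) (dsp : measure_display)
    (Omega : measurableType dsp) (P : probability Omega R) (m : nat)
    (p : 'I_m -> R) (X : nat -> Omega -> 'I_m) :
  iid_indices P p X ->
  {ae P, forall w, forall i,
    (\sum_(k < n) (X k w == i)%:R) / n%:R @[n --> \oo] --> p i}.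
Proof.
move=> [mX PX indep].
(* There are finitely many indices, so the exceptional null sets can be treated one index at a
   time. *)
apply: filter_forall => i.
have := @strong_law_events R dsp Omega P (fun k => X k @^-1` [set i]) (p i)
  (fun k => mX k _) (fun k => PX k i).
have PXX k l : k != l ->
    P (X k @^-1` [set i] `&` X l @^-1` [set i]) = (p i ^+ 2)%:E.
  (* Mutual independence on the two-element family gives the pairwise independence required by the
     strong law. *)
  move=> kl; have := indep [fset k; l]%fset (fun=> [set i]).
  rewrite big_fsetU1 /= ?inE // big_seq_fset1 !PX -EFinM -expr2 => <-.
  congr (P _); apply/seteqP; split=> w /=.
    by move=> [Xk Xl] j; rewrite /= !inE => /orP[] /eqP ->.
  by move=> H; split; apply: H; rewrite /= !inE eqxx ?orbT.
move=> /(_ PXX); apply: filterS => w.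
apply: cvg_trans; apply: near_eq_cvg; near=> n.
congr (_ / _); apply: eq_bigr => k _; rewrite indicE.
have -> // : (X k w == i) = (w \in X k @^-1` [set i]).
by apply/eqP/idP => [Xk|/set_mem//]; exact/mem_set.
Unshelve. all: by end_near. Qed.

Theorem theorem3 (R : realType) (d m : nat) (hd : (0 < d)%N)
    (T : 'I_m -> 'M[R[i]]_d)
    (htri : (forall i : 'I_m, is_upper_trig_mx (T i)) \/
            (forall i : 'I_m, is_trig_mx (T i)))
    (hdiag : forall (i : 'I_m) (j : 'I_d), T i j j != 0)
    (p : 'I_m -> R) (hp0 : forall i : 'I_m, 0 <= p i)
    (hp1 : \sum_(i < m) p i = 1)
    (dsp : measure_display) (Omega : measurableType dsp)
    (P : probability Omega R) (X : nat -> Omega -> 'I_m)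
    (hX : iid_indices P p X) :
  let E := [set w : Omega |
    random_spectral_radius T (fun k : nat => X k w) n @[n --> \oo] -->
      rho_infty T p] in
  {ae P, forall w : Omega, E w} /\ (measurable E /\ P E = 1%E).
Proof.
move=> E.
have [mX _ _] := hX.
have aeE : {ae P, forall w, E w}.
  apply: filterS (iid_indices_frequency_cvg hX) => w freq.
  exact: random_spectral_radius_cvg.
have mE : measurable E.
  by apply: measurable_cvg_set => n; exact: measurable_random_spectral_radius.
split=> //; split=> //.
(* The complement of [E] lies in a null set [N]; being measurable, it has probability 0 itself. *)
have [N [mN PN0 EN]] := aeE.
have PEC : P (~` E) = 0%E by apply: subset_measure0 PN0 => //; exact: measurableC.
by rewrite -(setCK E) probability_setC ?PEC ?sube0 //; exact: measurableC.
Qed.
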